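(* Let $n\ge 1$, let $x_0=a<x_1<\dots<x_n=b$ be equidistant nodes with step $h=\frac{b-a}{n}$, let $y:[a,b]\to\mathbb{R}$ be continuous, $y_k=y(x_k)$, and $\Delta_j=\frac{y_{j-1}-2y_j+y_{j+1}}{h^2}$ for $1\le j\le n-1$. For $k=1,\dots,n$ let $p_k(x)=\frac{x-x_{k-1}}{h}y_k-\frac{x-x_k}{h}y_{k-1}$ and $P_k(x)=p_k(x)+a_k(x-x_{k-1})(x-x_k)$ with $a_k\in\mathbb{R}$, and impose the conditions $P_k'(x_k)=P_{k+1}'(x_k)$ for $k=1,\dots,n-1$. Then $a_2,\dots,a_n$ are determined by $a_1$ through $$a_k=(-1)^{k+1}\Big(a_1+\sum_{j=1}^{k-1}(-1)^j\Delta_j\Big),\qquad 2\le k\le n,$$ and, regarded as a function of the remaining free parameter $a_1\in\mathbb{R}$, the quantity $$E(a_1)=\sum_{k=1}^n\int_{x_{k-1}}^{x_k}[P_k(x)-p_k(x)]^2\,dx$$ is minimized by $$a_1=-\frac1n\sum_{j=1}^{n-1}(n-j)(-1)^j\Delta_j .$$ For this choice of $a_1$ one has $$a_k=(-1)^{k+1}\sum_{j=1}^{n-1}\Big(\frac jn+s_j-1\Big)(-1)^j\Delta_j,\qquad 2\le k\le n,$$ where, for given $k$, $s_j=1$ if $j\le k-1$ and $s_j=0$ if $j>k-1$.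
   Context: Empty sums are equal to $0$. The function $S$ equal to $P_k$ on $[x_{k-1},x_k]$ for each $k$ is the quadratic spline interpolating $y$ at the nodes; the conditions $P_k'(x_k)=P_{k+1}'(x_k)$ express continuity of $S'$ at the interior nodes. *)

(* Defs.v *)
From Stdlib Require Import Reals Arith.
From Coquelicot Require Import Coquelicot.
Open Scope R_scope.

Definition step (n : nat) (a b : R) : R := (b - a) / INR n.

Definition node (n : nat) (a b : R) (k : nat) : R := a + INR k * step n a b.

(* Meaningful for 1 <= j <= n - 1: [j - 1] is truncated at j = 0. *)
Definition Delta2 (n : nat) (a b : R) (y : R -> R) (j : nat) : R :=
  (y (node n a b (j - 1)) - 2 * y (node n a b j) + y (node n a b (j + 1)))
  / step n a b ^ 2.

(* Meaningful for 1 <= k <= n: [k - 1] is truncated at k = 0. *)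
Definition lin_piece (n : nat) (a b : R) (y : R -> R) (k : nat) (x : R) : R :=
  (x - node n a b (k - 1)) / step n a b * y (node n a b k)
  - (x - node n a b k) / step n a b * y (node n a b (k - 1)).

(* The coefficient a_k is [c k]; only the entries with 1 <= k <= n matter. *)
Definition quad_piece (n : nat) (a b : R) (y : R -> R) (c : nat -> R)
    (k : nat) (x : R) : R :=
  lin_piece n a b y k x
  + c k * (x - node n a b (k - 1)) * (x - node n a b k).

Definition admissible (n : nat) (a b : R) (y : R -> R) (a1 : R)
    (c : nat -> R) : Prop :=
  c 1%nat = a1 /\
  forall k : nat, (1 <= k <= n - 1)%nat ->
    Derive (quad_piece n a b y c k) (node n a b k)
    = Derive (quad_piece n a b y c (k + 1)) (node n a b k).

Definition energy (n : nat) (a b : R) (y : R -> R) (c : nat -> R) : R :=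
  sum_n_m (fun k =>
    RInt (fun x => (quad_piece n a b y c k x - lin_piece n a b y k x) ^ 2)
      (node n a b (k - 1)) (node n a b k)) 1 n.

Definition a1_opt (n : nat) (a b : R) (y : R -> R) : R :=
  - (1 / INR n)
  * sum_n_m (fun j => (INR n - INR j) * (-1) ^ j * Delta2 n a b y j) 1 (n - 1).

Definition s_ind (k j : nat) : R := if (j <=? k - 1)%nat then 1 else 0.

(* Main.v *)
Require Import Defs.
From Stdlib Require Import Reals Arith Lra Lia.
From Coquelicot Require Import Coquelicot.
Open Scope R_scope.

(** The smoothness conditions amount to [a_k + a_(k+1) = Delta_k], so
    [a_k = (-1)^(k+1) (a_1 + T_k)] with [T_k = sum_(j<k) (-1)^j Delta_j].
    Since the integral of [((x-u)(x-v))^2] over [[u,v]] is [(v-u)^5/30], the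
    energy is [h^5/30 * sum_k (a_1 + T_k)^2], which is least when [a_1] is minus
    the mean of the [T_k]; exchanging the order of summation gives
    [sum_k T_k = sum_j (n-j) (-1)^j Delta_j]. *)

Lemma sum_n_m_1_0 (f : nat -> R) : sum_n_m f 1 0 = 0 :> R.
Proof. exact (sum_n_m_zero f 1 0 (Nat.lt_0_succ 0)). Qed.

Lemma sum_n_m_1_S (f : nat -> R) (m : nat) :
  sum_n_m f 1 (S m) = sum_n_m f 1 m + f (S m) :> R.
Proof. exact (sum_n_Sm f 1 m (le_n_S 0 m (Nat.le_0_l m))). Qed.

(** Exchange of summation: [f j] occurs in the inner sums with [j < k <= S m], that is [S m - j]
    times. *)
Lemma sum_n_m_partial_sums (f : nat -> R) (m : nat) :
  sum_n_m (fun k => sum_n_m f 1 (k - 1)) 1 (S m)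
  = sum_n_m (fun j => (INR (S m) - INR j) * f j) 1 m :> R.
Proof.
  induction m as [|m IH].
  - rewrite sum_n_m_1_S; simpl Nat.sub.
    rewrite !sum_n_m_1_0; ring.
  - rewrite sum_n_m_1_S, IH.
    replace (S (S m) - 1)%nat with (S m) by lia.
    rewrite !sum_n_m_1_S.
    (* Raising [m] by one raises each weight by one, which splits off one copy of the plain sum of
       [f]. *)
    rewrite (sum_n_m_ext (fun j => (INR (S (S m)) - INR j) * f j)
               (fun j => plus ((INR (S m) - INR j) * f j) (f j))).
    + rewrite sum_n_m_plus, (S_INR (S m)); unfold plus; simpl; ring.
    + intros j; rewrite (S_INR (S m)); unfold plus; simpl; ring.
Qed.

(** Completing the square: the hypothesis makes [t0] minus the mean of [T], so the cross term
    vanishes and the excess is [n (t - t0)^2]. *)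
Lemma sum_n_m_sqr_shift_min (T : nat -> R) (n : nat) (t0 t : R) :
  INR n * t0 + sum_n_m T 1 n = 0 ->
  sum_n_m (fun k => (t0 + T k) ^ 2) 1 n <= sum_n_m (fun k => (t + T k) ^ 2) 1 n.
Proof.
  intros H0.
  assert (H : sum_n_m (fun k => (t + T k) ^ 2) 1 n
              = sum_n_m (fun k => (t0 + T k) ^ 2) 1 n + INR n * (t - t0) ^ 2
                + 2 * (t - t0) * (INR n * t0 + sum_n_m T 1 n) :> R).
  (* The expansion holds for every [t0]; keeping [H0], which mentions [n], would make the induction
     hypothesis conditional. *)
  { clear H0; induction n as [|n IH].
    - rewrite !sum_n_m_1_0; simpl; ring.
    - rewrite !sum_n_m_1_S, IH, S_INR; ring. }
  rewrite H, H0.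
  assert (0 <= INR n * (t - t0) ^ 2)
    by (apply Rmult_le_pos; [apply pos_INR | apply pow2_ge_0]).
  lra.
Qed.

Lemma RInt_sqr_bump (c u v : R) :
  RInt (fun x => (c * (x - u) * (x - v)) ^ 2) u v = c ^ 2 * (v - u) ^ 5 / 30.
Proof.
  apply is_RInt_unique.
  (* With [s = x - u] and [d = v - u] the integrand is [c^2 (s^4 - 2 d s^3 + d^2 s^2)]; at [s = d]
     the constants give [1/5 - 1/2 + 1/3 = 1/30]. *)
  set (F := fun x => c ^ 2 * ((x - u) ^ 5 / 5 - (v - u) * (x - u) ^ 4 / 2
                              + (v - u) ^ 2 * (x - u) ^ 3 / 3)).
  replace (c ^ 2 * (v - u) ^ 5 / 30) with (minus (F v) (F u))
    by (unfold F, minus, plus, opp; simpl; field).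
  apply (is_RInt_derive F).
  - intros x _; unfold F; auto_derive; [exact I | field].
  - intros x _; apply (ex_derive_continuous (V := R_NormedModule)).
    auto_derive; exact I.
Qed.

Section Spline.

Variables (n : nat) (a b : R) (y : R -> R).
Hypotheses (hn : (1 <= n)%nat) (hab : a < b).

(** [T 1] is an empty sum, so the closed form of [a_k] also covers [k = 1]. *)
Let T (k : nat) : R := sum_n_m (fun j => (-1) ^ j * Delta2 n a b y j) 1 (k - 1).

Lemma step_pos : 0 < step n a b.
Proof.
  unfold step; apply Rdiv_lt_0_compat; [lra | apply lt_0_INR; lia].
Qed.

Lemma node_pred (k : nat) :
  (1 <= k)%nat -> node n a b (k - 1) = node n a b k - step n a b.
Proof.
  intros Hk; unfold node; rewrite minus_INR by lia; simpl; ring.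
Qed.

Lemma Derive_quad_piece (c : nat -> R) (k : nat) (x : R) :
  Derive (quad_piece n a b y c k) x
  = (y (node n a b k) - y (node n a b (k - 1))) / step n a b
    + c k * ((x - node n a b (k - 1)) + (x - node n a b k)).
Proof.
  apply is_derive_unique; unfold quad_piece, lin_piece.
  pose proof step_pos; auto_derive; [exact I | field; lra].
Qed.

(** At the common node the quadratic terms have slopes [h c_k] and [- h c_(k+1)], while the chord
    slopes differ by [h Delta_k]. *)
Lemma smooth_at_node (c : nat -> R) (k : nat) :
  (1 <= k)%nat ->
  Derive (quad_piece n a b y c k) (node n a b k)
  = Derive (quad_piece n a b y c (k + 1)) (node n a b k)
  <-> c k + c (k + 1)%nat = Delta2 n a b y k.
Proof.
  intros Hk; pose proof step_pos as Hh.
  rewrite !Derive_quad_piece; unfold Delta2.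
  replace (k + 1 - 1)%nat with k by lia.
  assert (Hs : node n a b (k + 1) = node n a b k + step n a b)
    by (unfold node; rewrite plus_INR; simpl; ring).
  rewrite !(node_pred k) by lia.
  set (y0 := y (node n a b k - step n a b)); set (y2 := y (node n a b (k + 1))).
  rewrite Hs; set (h := step n a b) in *; set (y1 := y (node n a b k)).
  assert (E : (y0 - 2 * y1 + y2) / h ^ 2
              = ((y2 - y1) / h - (y1 - y0) / h) / h) by (field; lra).
  rewrite E; split; intros H.
  - apply (Rmult_eq_reg_r h); [|lra].
    unfold Rdiv at 1; rewrite Rmult_assoc, Rinv_l by lra; lra.
  - apply (f_equal (fun z => z * h)) in H.
    unfold Rdiv at 1 in H; rewrite (Rmult_assoc _ (/ h)), Rinv_l in H by lra; lra.
Qed.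

(** The opposite signs cancel [t + T k]; what remains is the new summand [(-1)^k Delta_k] times a
    sign of the same parity. *)
Lemma coef_succ (t : R) (k : nat) :
  (1 <= k)%nat ->
  (-1) ^ (k + 1) * (t + T k) + (-1) ^ (k + 1 + 1) * (t + T (k + 1))
  = Delta2 n a b y k.
Proof.
  intros Hk; unfold T; destruct k as [|k]; [lia|].
  replace (S k + 1 - 1)%nat with (S k) by lia.
  replace (S k - 1)%nat with k by lia.
  rewrite sum_n_m_1_S.
  replace (S k + 1 + 1)%nat with (S (S (S k))) by lia.
  replace (S k + 1)%nat with (S (S k)) by lia.
  assert (Hsq : (-1) ^ k * (-1) ^ k = 1)
    by (rewrite <- Rpow_mult_distr; replace (-1 * -1) with 1 by ring; apply pow1).
  simpl; set (s := (-1) ^ k) in *; set (D := Delta2 n a b y (S k)).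
  transitivity (s * s * D); [ring | rewrite Hsq; ring].
Qed.

Lemma admissible_coef (t : R) (c : nat -> R) :
  admissible n a b y t c ->
  forall k : nat, (1 <= k <= n)%nat -> c k = (-1) ^ (k + 1) * (t + T k).
Proof.
  intros [H1 Hs] k; induction k as [|k IH]; intros Hk; [lia|].
  destruct k as [|k].
  - unfold T; simpl (1 - 1)%nat; rewrite H1, sum_n_m_1_0; simpl; ring.
  - assert (HD := proj1 (smooth_at_node c (S k) ltac:(lia)) (Hs (S k) ltac:(lia))).
    assert (HC := coef_succ t (S k) ltac:(lia)).
    rewrite IH in HD by lia.
    replace (S (S k)) with (S k + 1)%nat by lia; lra.
Qed.

(** The closed form itself is the witness; hence [a_1] is indeed a free parameter. *)
Lemma admissible_exists (t : R) : exists c : nat -> R, admissible n a b y t c.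
Proof.
  exists (fun k => (-1) ^ (k + 1) * (t + T k)); split.
  - unfold T; simpl (1 - 1)%nat; rewrite sum_n_m_1_0; simpl; ring.
  - intros k Hk; apply smooth_at_node; [lia|]; apply coef_succ; lia.
Qed.

Lemma energy_admissible (t : R) (c : nat -> R) :
  admissible n a b y t c ->
  energy n a b y c
  = step n a b ^ 5 / 30 * sum_n_m (fun k => (t + T k) ^ 2) 1 n.
Proof.
  intros Hc; unfold energy.
  rewrite <- (sum_n_m_mult_l (K := R_Ring)).
  apply sum_n_m_ext_loc; intros k Hk.
  rewrite (RInt_ext _ (fun x => (c k * (x - node n a b (k - 1))
                                     * (x - node n a b k)) ^ 2))
    by (intros x _; unfold quad_piece; f_equal; ring).
  rewrite RInt_sqr_bump, (node_pred k) by lia.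
  rewrite (admissible_coef t c Hc k Hk), Rpow_mult_distr.
  assert (Hsq : ((-1) ^ (k + 1)) ^ 2 = 1)
    by (rewrite <- pow_mult, Nat.mul_comm; apply pow_1_even).
  rewrite Hsq; unfold mult; simpl; field.
Qed.

(** This is the vanishing condition on the cross term in [sum_n_m_sqr_shift_min]. *)
Lemma a1_opt_mean : INR n * a1_opt n a b y + sum_n_m T 1 n = 0.
Proof.
  assert (Hn : INR n <> 0) by (apply not_0_INR; lia).
  assert (HT : sum_n_m T 1 n
     = sum_n_m (fun j => (INR n - INR j) * (-1) ^ j * Delta2 n a b y j) 1 (n - 1) :> R).
  { pose proof (sum_n_m_partial_sums (fun j => (-1) ^ j * Delta2 n a b y j) (n - 1))
      as H.
    replace (S (n - 1)) with n in H by lia.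
    unfold T; rewrite H.
    apply sum_n_m_ext; intros j; symmetry; apply Rmult_assoc. }
  rewrite HT; unfold a1_opt; field; exact Hn.
Qed.

(** The indicator brings [T k] to the index range of [a1_opt], so that the two can be added
    termwise. *)
Lemma sum_s_ind (f : nat -> R) (k m : nat) :
  (k - 1 <= m)%nat ->
  sum_n_m (fun j => s_ind k j * f j) 1 m = sum_n_m f 1 (k - 1) :> R.
Proof.
  induction m as [|m IH]; intros Hk.
  - replace (k - 1)%nat with 0%nat by lia; rewrite !sum_n_m_1_0; reflexivity.
  - rewrite sum_n_m_1_S.
    destruct (Nat.eq_dec (k - 1) (S m)) as [E|E].
    + rewrite E, sum_n_m_1_S.
      assert (Hs : forall j, (j <= S m)%nat -> s_ind k j = 1).
      { intros j Hj; unfold s_ind; rewrite (proj2 (Nat.leb_le _ _)); [reflexivity | lia]. }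
      rewrite (Hs (S m)) by lia.
      rewrite (sum_n_m_ext_loc (fun j => s_ind k j * f j) f)
        by (intros j Hj; rewrite Hs by lia; apply Rmult_1_l).
      ring.
    + rewrite IH by lia; unfold s_ind.
      rewrite (proj2 (Nat.leb_gt _ _)) by lia; ring.
Qed.

(** Termwise, [-(n - j)/n + s_j = j/n + s_j - 1]. *)
Lemma a1_opt_shift (k : nat) :
  (k <= n)%nat ->
  a1_opt n a b y + T k
  = sum_n_m (fun j => (INR j / INR n + s_ind k j - 1) * (-1) ^ j
                      * Delta2 n a b y j) 1 (n - 1).
Proof.
  intros Hk; assert (Hn : INR n <> 0) by (apply not_0_INR; lia).
  unfold a1_opt, T.
  rewrite <- (sum_s_ind _ k (n - 1)) by lia.
  rewrite <- (sum_n_m_mult_l (K := R_Ring)).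
  rewrite <- (sum_n_m_plus (G := R_AbelianMonoid)).
  apply sum_n_m_ext; intros j; unfold mult, plus; simpl.
  match goal with |- ?l = ?r => change (l = r :> R) end; field; exact Hn.
Qed.

End Spline.

Theorem mainTheorem1 (n : nat) (a b : R) (y : R -> R)
  (hn : (1 <= n)%nat) (hab : a < b)
  (hy : continuous_on (fun x => a <= x <= b) y) :
  (forall (a1 : R) (c : nat -> R), admissible n a b y a1 c ->
     forall k : nat, (2 <= k <= n)%nat ->
       c k = (-1) ^ (k + 1)
             * (a1 + sum_n_m (fun j => (-1) ^ j * Delta2 n a b y j) 1 (k - 1)))
  /\ (forall a1 : R, exists c : nat -> R, admissible n a b y a1 c)
  /\ (forall c0 : nat -> R, admissible n a b y (a1_opt n a b y) c0 ->
      forall (a1 : R) (c : nat -> R), admissible n a b y a1 c ->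
        energy n a b y c0 <= energy n a b y c)
  /\ (forall c : nat -> R, admissible n a b y (a1_opt n a b y) c ->
      forall k : nat, (2 <= k <= n)%nat ->
        c k = (-1) ^ (k + 1)
              * sum_n_m (fun j =>
                  (INR j / INR n + s_ind k j - 1) * (-1) ^ j * Delta2 n a b y j)
                  1 (n - 1)).
Proof.
  split; [|split; [|split]].
  - intros a1 c Hc k Hk; apply admissible_coef; [assumption..|lia].
  - intros a1; apply admissible_exists; assumption.
  - intros c0 Hc0 a1 c Hc.
    (* Both energies carry the same factor [h^5/30], so only the sums of squares need comparing. *)
    rewrite (energy_admissible n a b y hn hab _ _ Hc0),
      (energy_admissible n a b y hn hab _ _ Hc).
    apply Rmult_le_compat_l.
    + assert (0 < step n a b ^ 5) by (apply pow_lt, step_pos; assumption); lra.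
    + apply sum_n_m_sqr_shift_min, a1_opt_mean; assumption.
  - intros c Hc k Hk.
    rewrite (admissible_coef n a b y hn hab _ _ Hc k) by lia.
    f_equal; apply a1_opt_shift; lia.
Qed.
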